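(* Let $q\ge3$ be an integer. Assume DRH(A) for $L(s,\chi)$ and $L(\frac12,\chi)\neq0$ for the nontrivial Dirichlet characters $\chi$ modulo $q$. If $m(\sigma_a)=0$ for any $a\in(\mathbb Z/q\mathbb Z)^\times$, then there exists a Chebyshev bias against primes which are quadratic residues modulo $q$.
   Context: Let $G=\mathrm{Gal}(\mathbb Q(\zeta_q)/\mathbb Q)\cong(\mathbb Z/q\mathbb Z)^\times$, with $a\in(\mathbb Z/q\mathbb Z)^\times$ corresponding to the Artin symbol $\sigma_a=\left(\frac{\mathbb Q(\zeta_q)/\mathbb Q}{(a)}\right)$; characters of $G$ are identified with Dirichlet characters modulo $q$. For a nontrivial Dirichlet character $\chi$ modulo $q$, $m_\chi=\mathrm{ord}_{s=1/2}L(s,\chi)$, and $m(\sigma_a)=\sum_{\chi\ne\mathbf 1}\chi(a)m_\chi$, the sum running over nontrivial Dirichlet characters modulo $q$. DRH(A) for $L(s,\chi)$ (the Deep Riemann Hypothesis (A)) is the statement that the limit $$\lim_{x\to\infty}\left((\log x)^{m_\chi}\prod_{p\le x:\,\text{prime}}\left(1-\chi(p)p^{-1/2}\right)^{-1}\right)$$ exists and is nonzero. A quadratic residue modulo $q$ is an element of $((\mathbb Z/q\mathbb Z)^\times)^2$. Chebyshev bias (over $\mathbb Q$): suppose the set of all primes $p\le x$ is a disjoint union $P_1(x)\cup P_2(x)$ and the limit $\delta=\lim_{x\to\infty}|P_1(x)|/|P_2(x)|$ exists. There exists a Chebyshev bias toward $P_1$, or equivalently against $P_2$, if for some $C>0$,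 $$\sum_{p\in P_1(x)}\frac1{\sqrt p}-\delta\sum_{p\in P_2(x)}\frac1{\sqrt p}\sim C\log\log x\qquad(x\to\infty),$$ where $f\sim g$ means $f(x)/g(x)\to1$. Here $P_2$ consists of the primes which are quadratic residues modulo $q$ and $P_1$ of the remaining primes. *)

(* Defs.v *)
From HB Require Import structures.
From mathcomp Require Import all_boot all_order all_algebra.
From mathcomp Require Import all_classical all_reals all_analysis.
From mathcomp Require Import complex.

Set Implicit Arguments.
Unset Strict Implicit.
Unset Printing Implicit Defensive.

Import Order.TTheory GRing.Theory Num.Theory.
Import numFieldNormedType.Exports.

Local Open Scope classical_set_scope.
Local Open Scope complex_scope.
Local Open Scope ring_scope.

(* [R[i]^o] is [R[i]] with the topology of its norm, seen as a normed module
   over itself; differentiability over [R[i]] is complex differentiability. *)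
Notation Cplx R := (R[i]^o).

(* The order of vanishing at [z0] of a function holomorphic near [z0].  When
   [f] vanishes identically near [z0] no order exists, and the value is 0. *)
Definition has_order (R : realType) (f : Cplx R -> Cplx R) (z0 : Cplx R)
    (m : nat) : Prop :=
  exists g : Cplx R -> Cplx R,
    [/\ \forall z \near z0, derivable g z 1,
        g z0 != 0
      & \forall z \near z0, f z = (z - z0) ^+ m * g z].

Definition order_at (R : realType) (f : Cplx R -> Cplx R) (z0 : Cplx R) : nat :=
  xget 0%N [set m | has_order f z0 m].

(* [n ^ (- s) = n ^ (- Re s) * exp (- i * Im s * ln n)], for [0 < n]. *)
Definition natcpowN (R : realType) (n : nat) (s : Cplx R) : Cplx R :=
  let t := complex.Im s * ln (n%:R : R) in
  ((n%:R : R) `^ (- complex.Re s))%:C * (cos t -i* sin t).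

(* The modulus is meant to satisfy [1 < q], as ['Z_q] is Z/2Z for [q <= 1]. *)
Definition is_dirichlet_character (R : realType) (q : nat)
    (chi : {ffun 'Z_q -> Cplx R}) : Prop :=
  [/\ chi 1 = 1,
      forall a b, chi (a * b) = chi a * chi b
    & forall a, (chi a != 0) = (a \is a GRing.unit)].

Definition principal_character (R : realType) (q : nat) :
    {ffun 'Z_q -> Cplx R} :=
  [ffun a => (a \is a GRing.unit)%:R].

Definition nontrivial_characters (R : realType) (q : nat) :
    set {ffun 'Z_q -> Cplx R} :=
  [set chi | is_dirichlet_character chi /\ chi <> principal_character R q].
Arguments nontrivial_characters : clear implicits.

(* [L] is entire and is given by the Dirichlet series of [chi] on [1 < Re s].
   For nontrivial [chi] there is exactly one such [L]; for the principal
   character there is none (pole at 1). *)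
Definition is_dirichlet_L (R : realType) (q : nat)
    (chi : {ffun 'Z_q -> Cplx R}) (L : Cplx R -> Cplx R) : Prop :=
  (forall s : Cplx R, derivable L s 1) /\
  (forall s : Cplx R, 1 < complex.Re s ->
    (fun N : nat => \sum_(1 <= n < N.+1) chi n%:R * natcpowN n s : Cplx R)
      @ \oo --> L s).

Definition dirichlet_L (R : realType) (q : nat)
    (chi : {ffun 'Z_q -> Cplx R}) : Cplx R -> Cplx R :=
  xget (fun=> 0) [set L | is_dirichlet_L chi L].

Definition m_chi (R : realType) (q : nat) (chi : {ffun 'Z_q -> Cplx R}) : nat :=
  order_at (dirichlet_L chi) (2^-1 : R)%:C.

(* A sum over the finite set of nontrivial Dirichlet characters modulo [q];
   [a] stands for the Artin symbol [sigma_a]. *)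
Definition m_sigma (R : realType) (q : nat) (a : 'Z_q) : Cplx R :=
  \sum_(chi \in nontrivial_characters R q) (chi a * (m_chi chi)%:R).

Definition DRH_A (R : realType) (q : nat) (chi : {ffun 'Z_q -> Cplx R}) : Prop :=
  exists2 l : Cplx R, l != 0 &
    (((ln x) ^+ m_chi chi)%:C *
     \prod_(p < (Num.truncn x).+1 | prime p)
        (1 - chi p%:R * ((Num.sqrt (p%:R : R))^-1)%:C)^-1 : Cplx R)
      @[x --> (+oo : set_system R)] --> l.

(* For a set [P] of primes, [P(x)] is the set of the [p <= x] in [P]. *)
Definition count_upto (R : realType) (P : pred nat) (x : R) : R :=
  #|[pred p : 'I_(Num.truncn x).+1 | P p]|%:R.

Definition sum_inv_sqrt (R : realType) (P : pred nat) (x : R) : R :=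
  \sum_(p < (Num.truncn x).+1 | P p) (Num.sqrt (p%:R : R))^-1.

(* Bias toward [P1], i.e. against [P2]; the existence of the limit [delta] is
   part of the assertion. *)
Definition chebyshev_bias (R : realType) (P1 P2 : pred nat) : Prop :=
  [/\ forall p, prime p = P1 p || P2 p,
      forall p, ~~ (P1 p && P2 p)
    & exists2 delta : R,
        count_upto P1 x / count_upto P2 x @[x --> (+oo : set_system R)]
          --> delta &
        exists2 C : R, 0 < C &
          (sum_inv_sqrt P1 x - delta * sum_inv_sqrt P2 x) / (C * ln (ln x))
            @[x --> (+oo : set_system R)] --> (1 : R)].

Definition is_quadratic_residue (q : nat) (b : 'Z_q) : bool :=
  [exists u : 'Z_q, (u \is a GRing.unit) && (b == u ^+ 2)].

Definition residue_primes (q : nat) : pred nat :=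
  fun p => prime p && is_quadratic_residue (p%:R : 'Z_q).

Definition nonresidue_primes (q : nat) : pred nat :=
  fun p => prime p && ~~ is_quadratic_residue (p%:R : 'Z_q).

(* Main.v *)
(* With [L (1/2, chi) <> 0] all [m_chi] vanish, so for a quadratic character
   [chi] the product of [(1 - chi p / sqrt p)^-1] over [p <= x] is bounded away
   from 0 and infinity.  Taking logarithms and expanding to second order,
   [\sum chi p / sqrt p = - 1/2 \sum chi p ^ 2 / p + O(1)], which by Mertens'
   theorem is [- 1/2 ln (ln x) + O(1)].  Let [k] be the number of characters
   with values in {-1, 0, 1}, the principal one included; their sum is [k]
   times the indicator of the squares, so that the weighted count of
   nonresidues minus [k - 1] times that of residues is minus the sum over the
   [k - 1] nonprincipal quadratic characters, up to primes dividing [q].  With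
   weights [1 / sqrt p] this is [(k - 1)/2 ln (ln x) + O(1)].  With weights 1,
   summation by parts gives [O(sqrt x * ln x)], negligible against the number
   of primes up to [x], whence [delta = k - 1]. *)
Require Import Defs.
From HB Require Import structures.
From mathcomp Require Import all_boot all_order all_algebra.
From mathcomp Require Import all_classical all_reals all_analysis.
From mathcomp Require Import complex.
From mathcomp Require Import zify ring lra.

Set Implicit Arguments.
Unset Strict Implicit.
Unset Printing Implicit Defensive.

Import Order.TTheory GRing.Theory Num.Theory.
Import numFieldNormedType.Exports.

Local Open Scope classical_set_scope.
Local Open Scope complex_scope.
Local Open Scope ring_scope.

(** * Chebyshev and Mertens estimates *)

Lemma ln_prod (R : realType) (I : Type) (r : seq I) (P : pred I) (F : I -> R) :
  (forall i, P i -> 0 < F i) ->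
  ln (\prod_(i <- r | P i) F i) = \sum_(i <- r | P i) ln (F i).
Proof.
move=> F_gt0.
have [] // : 0 < \prod_(i <- r | P i) F i /\
  ln (\prod_(i <- r | P i) F i) = \sum_(i <- r | P i) ln (F i).
apply: (big_ind2 (fun x y : R => 0 < x /\ ln x = y)) => [|x y x' y' [x0 <-] [x'0 <-]|i Pi].
- by rewrite ln1.
- by rewrite mulr_gt0// lnM// posrE.
- by rewrite F_gt0.
Qed.

Lemma ln_le_subr1 (R : realType) (x : R) : 0 < x -> ln x <= x - 1.
Proof.
move=> x0; have -> : ln x = ln (1 + (x - 1)) by rewrite addrC subrK.
by apply: le_ln1Dx; lra.
Qed.

Lemma ln_ge_1subV (R : realType) (x : R) : 0 < x -> 1 - x^-1 <= ln x.
Proof.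
move=> x0; have := ln_le_subr1 (x := x^-1); rewrite invr_gt0 => /(_ x0).
by rewrite lnV ?posrE//; lra.
Qed.

Lemma ln_natr_ge0 (R : realType) (n : nat) : 0 <= ln n%:R :> R.
Proof. by case: n => [|n]; [rewrite ln0|rewrite ln_ge0// ler1n]. Qed.

Lemma ler_ln_nat (R : realType) (m n : nat) :
  (m <= n)%N -> ln m%:R <= ln n%:R :> R.
Proof.
case: m => [|m] mn; first by rewrite [leLHS]ln0// ln_natr_ge0.
by rewrite ler_ln ?posrE ?ltr0n ?ler_nat//; exact: leq_trans mn.
Qed.

Lemma ln_natr_gt0 (R : realType) (n : nat) : (1 < n)%N -> 0 < ln n%:R :> R.
Proof. by move=> n1; rewrite ln_gt0// ltr1n. Qed.

Lemma ln_nat_factor (R : realType) (N n : nat) : (0 < n)%N ->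
  (forall p, prime p -> (p %| n)%N -> (p <= N)%N) ->
  ln n%:R = \sum_(0 <= p < N.+1 | prime p) (logn p n)%:R * ln p%:R :> R.
Proof.
move=> n0 nN; rewrite -[in LHS](partnT n0) (widen_partn _ (leq_maxr N n)).
rewrite big_mkcond/=.
rewrite (eq_bigr (fun p => if prime p then p ^ logn p n else 1)%N); last first.
  by move=> p _; case: ifPn => // pr; rewrite lognE (negbTE pr).
rewrite -big_mkcond natr_prod ln_prod => [|p pr]; last first.
  by rewrite natrX exprn_gt0// ltr0n prime_gt0.
rewrite (@big_cat_nat _ _ _ N.+1)//=; last by rewrite ltnS leq_maxl.
rewrite [X in _ + X]big1_seq ?addr0; last first.
  move=> p /andP[pr]; rewrite mem_index_iota => /andP[Np _].
  rewrite lognE pr n0/=; case: ifP => [/(nN _ pr)|_]; last by rewrite ln1.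
  by rewrite leqNgt Np.
apply: eq_bigr => p pr; rewrite natrX lnXn ?ltr0n ?prime_gt0//.
by rewrite mulr_natl.
Qed.

(** * Prime factorization of factorials *)

Lemma logn_fact_ge (p n : nat) : prime p -> (n %/ p <= logn p n`!)%N.
Proof.
move=> pr; rewrite logn_fact//; case: n => [|n]; first by rewrite div0n.
by rewrite big_ltn// expn1 leq_addr.
Qed.

(** Legendre's formula is dominated by the geometric series of [n / p ^ k], whose sum is
    [n / (p - 1)]. *)
Lemma logn_fact_le (p n : nat) : prime p -> (p.-1 * logn p n`! <= n)%N.
Proof.
move=> pr; have p0 := prime_gt0 pr; rewrite logn_fact//.
(* The remainder [n %/ p ^ m] makes the induction close: [p - 1] copies of the new quotient together
   with the new remainder are [p] copies of it, at most the old remainder. *)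
suff H m : (p.-1 * (\sum_(1 <= k < m.+1) n %/ p ^ k) + n %/ p ^ m <= n)%N.
  by apply: leq_trans (H n); rewrite leq_addr.
elim: m => [|m IHm]; first by rewrite big_geq// muln0 expn0 divn1.
rewrite big_nat_recr//=.
have : ((n %/ p ^ m.+1) * p <= n %/ p ^ m)%N.
  by rewrite expnSr divnMA leq_divM.
move: IHm; move: (\sum_(_ <= _ < _) _)%N (n %/ p ^ m.+1)%N (n %/ p ^ m)%N => S a b.
case: p {pr} p0 => // p _ /=; nia.
Qed.

Lemma prime_dvd_fact (p n : nat) : prime p -> (p %| n`!)%N -> (p <= n)%N.
Proof.
move=> pr; elim: n => [|n IHn].
  by rewrite fact0 dvdn1 => /eqP p1; rewrite p1 in pr.
by rewrite factS Euclid_dvdM// => /orP[/dvdn_leq->//|/IHn/leqW].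
Qed.

Lemma ln_factE (R : realType) (n : nat) : ln (n`!)%:R =
  \sum_(0 <= p < n.+1 | prime p) (logn p n`!)%:R * ln p%:R :> R.
Proof.
by apply: ln_nat_factor => [|p]; [exact: fact_gt0|exact: prime_dvd_fact].
Qed.

Lemma ln_fact_le (R : realType) (n : nat) :
  ln (n`!)%:R <= n%:R * ln n%:R :> R.
Proof.
elim: n => [|n IHn]; first by rewrite fact0 ln1 mul0r.
rewrite factS natrM lnM ?posrE ?ltr0n ?fact_gt0//.
have : n%:R * ln n%:R <= n%:R * ln n.+1%:R :> R.
  by rewrite ler_wpM2l// ler_ln_nat.
have -> : n.+1%:R * ln n.+1%:R = n%:R * ln n.+1%:R + ln n.+1%:R :> R.
  by rewrite -natr1 mulrDl mul1r.
lra.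
Qed.

(** The easy half of Stirling's formula: the induction step reduces to
    [n * ln ((n + 1) / n) <= 1]. *)
Lemma ln_fact_ge (R : realType) (n : nat) :
  n%:R * ln n%:R - n%:R <= ln (n`!)%:R :> R.
Proof.
elim: n => [|n IHn]; first by rewrite fact0 ln1 mul0r subr0.
rewrite factS natrM lnM ?posrE ?ltr0n ?fact_gt0//.
suff : n%:R * ln n.+1%:R - n%:R * ln n%:R <= 1 :> R.
  have -> : n.+1%:R * ln n.+1%:R = n%:R * ln n.+1%:R + ln n.+1%:R :> R.
    by rewrite -natr1 mulrDl mul1r.
  have : n.+1%:R = n%:R + 1 :> R by rewrite natr1.
  lra.
case: n {IHn} => [|n]; first by rewrite !mul0r subr0.
rewrite -mulrBr -ln_div ?posrE ?ltr0n//.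
have n0 : 0 < n.+1%:R :> R by rewrite ltr0n.
have := ln_le_subr1 (x := n.+2%:R / n.+1%:R :> R).
rewrite divr_gt0 ?ltr0n// => /(_ isT) /(ler_wpM2l (ltW n0)) /le_trans; apply.
rewrite mulrBr mulrCA divff ?lt0r_neq0// -[n.+2%:R]natr1; lra.
Qed.

(** * Chebyshev's upper bound for the sum of [ln p] over primes *)

Lemma bin_le_exp2 (n m : nat) : ('C(n, m) <= 2 ^ n)%N.
Proof.
elim: n m => [|n IHn] [|m]; rewrite ?bin0 ?bin0n ?expn_gt0//.
by rewrite binS expnS mul2n -addnn leq_add.
Qed.

(** A prime between [m + 1] and [2m] divides [(2m)!] but not [m!], so it divides the central
    binomial coefficient, which is at most [2 ^ (2m)]. *)
Lemma theta_double (R : realType) (m : nat) :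
  \sum_(m.+1 <= p < (m.*2).+1 | prime p) ln p%:R <= m.*2%:R * ln 2 :> R.
Proof.
have B0 : (0 < 'C(m.*2, m))%N by rewrite bin_gt0 -addnn leq_addr.
have FE : ('C(m.*2, m) * (m`! * m`!) = (m.*2)`!)%N.
  by rewrite -[RHS](@bin_fact m.*2 m) -addnn ?addnK// leq_addr.
have : ln 'C(m.*2, m)%:R <= m.*2%:R * ln 2 :> R.
  rewrite mulr_natl -lnXn// -natrX ler_ln ?posrE ?ltr0n ?expn_gt0// ler_nat.
  exact: bin_le_exp2.
apply: le_trans; rewrite (@ln_nat_factor _ m.*2)//; last first.
  move=> p pr pB; apply: (prime_dvd_fact pr).
  by rewrite -FE; exact: dvdn_mulr.
rewrite [leRHS](@big_cat_nat _ _ _ m.+1)//=; last by rewrite ltnS -addnn leq_addr.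
rewrite -[leLHS]add0r lerD ?sumr_ge0// => [i _|].
  by rewrite mulr_ge0 ?ln_natr_ge0.
rewrite big_seq_cond [leRHS]big_seq_cond; apply: ler_sum => p.
rewrite mem_index_iota => /andP[/andP[mp pm] pr].
rewrite -{1}(mul1r (ln _)) ler_wpM2r ?ln_natr_ge0// ler1n logn_gt0 mem_primes.
rewrite pr B0/=.
have : (p %| (m.*2)`!)%N by rewrite dvdn_fact// prime_gt0.
rewrite -FE !Euclid_dvdM// orbb => /orP[//|pm'].
by have := prime_dvd_fact pr pm'; rewrite leqNgt mp.
Qed.

Lemma theta_pow2 (R : realType) (k : nat) :
  \sum_(0 <= p < (2 ^ k).+1 | prime p) ln p%:R <= (2 ^ k).*2%:R * ln 2 :> R.
Proof.
elim: k => [|k IHk].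
  by rewrite big_mkcond/= big_ltn// big_nat1/= addr0 mulr_ge0// ln_natr_ge0.
rewrite expnS mul2n (@big_cat_nat _ _ _ (2 ^ k).+1)//=; last first.
  by rewrite ltnS -addnn leq_addr.
apply: le_trans (lerD IHk (theta_double R (2 ^ k))) _.
by rewrite -!muln2 !natrM; lra.
Qed.

(** Rounding [n] up to a power of two at most doubles it, which turns the constant 2 of [theta_pow2]
    into 4. *)
Lemma theta_le (R : realType) (n : nat) :
  \sum_(0 <= p < n.+1 | prime p) ln p%:R <= 4 * n%:R * ln 2 :> R.
Proof.
case: n => [|n]; first by rewrite big_mkcond/= big_nat1 mulr0 mul0r.
have /andP[lo hi] := trunc_log_bounds (isT : (1 < 2)%N) (ltn0Sn n).
apply: le_trans (_ :
  \sum_(0 <= p < (2 ^ (trunc_log 2 n.+1).+1).+1 | prime p) ln p%:R <= _).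
  rewrite [leRHS](@big_cat_nat _ _ _ n.+2)//=; last by rewrite ltnS ltnW.
  by rewrite lerDl sumr_ge0// => i _; rewrite ln_natr_ge0.
apply: le_trans (theta_pow2 R _) _.
rewrite ler_wpM2r ?ln_natr_ge0// -natrM ler_nat expnS; lia.
Qed.

(** * Summation by parts and Mertens' theorems *)

Lemma summation_by_parts_le (R : realType) (f a : nat -> R) (B : R) (m N : nat) :
  (m <= N)%N ->
  (forall n, (m <= n <= N)%N -> `|\sum_(m <= i < n) a i| <= B) ->
  `|\sum_(m <= i < N) f i * a i| <=
    B * (`|f N| + \sum_(m <= i < N) `|f i.+1 - f i|).
Proof.
move=> mN aB; pose A n := \sum_(m <= i < n) a i.
have -> : \sum_(m <= i < N) f i * a i =
    f N * A N - \sum_(m <= i < N) (f i.+1 - f i) * A i.+1.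
  elim: N mN {aB} => [|N IHN].
    by rewrite leqn0 => /eqP m0; rewrite /A m0 !big_geq// mulr0 subr0.
  rewrite leq_eqVlt => /predU1P[m1|mN].
    by rewrite /A m1 !big_geq// mulr0 subr0.
  have AS : A N.+1 = A N + a N by rewrite /A big_nat_recr.
  by rewrite !big_nat_recr//= IHN// AS; ring.
rewrite mulrDr; apply: le_trans (ler_normB _ _) (lerD _ _).
  by rewrite normrM mulrC ler_wpM2r// aB// mN leqnn.
apply: le_trans (ler_norm_sum _ _ _) _; rewrite mulr_sumr.
apply: ler_sum_nat => i /andP[mi iN]; rewrite normrM mulrC ler_wpM2r// aB//.
by rewrite iN (leq_trans mi).
Qed.

Lemma sum_invsqrt3_le (R : realType) (N : nat) :
  \sum_(0 <= n < N.+1) (Num.sqrt n%:R)^-1 ^+ 3 <= 3 :> R.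
Proof.
(* Comparison with a telescoping series in [2 / sqrt n]. The term at [n = 0] vanishes because
   [0^-1 = 0]. *)
suff H n : \sum_(0 <= n < n.+2) (Num.sqrt n%:R)^-1 ^+ 3 <=
    3 - 2 * (Num.sqrt n.+1%:R)^-1 :> R.
  case: N => [|N]; first by rewrite big_nat1 sqrtr0 invr0 expr0n/=.
  by apply: le_trans (H N) _; rewrite gerBl mulr_ge0// invr_ge0 sqrtr_ge0.
elim: n => [|n IHn].
  by rewrite big_ltn// big_nat1 sqrtr0 invr0 expr0n/= sqrtr1 invr1; lra.
rewrite big_nat_recr//=; apply: le_trans (lerD IHn (lexx _)) _.
set a := (Num.sqrt n.+1%:R)^-1; set b := (Num.sqrt n.+2%:R)^-1.
have a0 : 0 < a by rewrite invr_gt0 sqrtr_gt0 ltr0n.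
have b0 : 0 < b by rewrite invr_gt0 sqrtr_gt0 ltr0n.
have ba : b <= a.
  by rewrite lef_pV2 ?posrE ?sqrtr_gt0 ?ltr0n// ler_wsqrtr// ler_nat.
have ab : a ^+ 2 - b ^+ 2 = a ^+ 2 * b ^+ 2.
  rewrite !exprVn !sqr_sqrtr ?ler0n// -[n.+2%:R]natr1.
  have : n.+1%:R != 0 :> R by rewrite pnatr_eq0.
  have : n.+1%:R + 1 != 0 :> R by rewrite natr1 pnatr_eq0.
  by move=> ? ?; field; apply/andP.
(* After multiplication by [a] this reads [(a - b) * (a + b) <= 2 * a * (a - b)], by [ab], and
   follows from [b <= a]. *)
suff : a * b ^+ 2 <= 2 * (a - b).
  have : b * b ^+ 2 <= a * b ^+ 2 by rewrite ler_wpM2r// exprn_ge0// ltW.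
  by rewrite -exprS; lra.
rewrite -(ler_pM2l a0) mulrA -expr2 -ab subr_sqr mulrC mulrCA (mulrC a).
rewrite mulrA (mulrC 2) -mulrA; rewrite mulrC ler_wpM2l ?subr_ge0//; lra.
Qed.

Lemma ln_le_2sqrt (R : realType) (x : R) : 0 < x -> ln x <= 2 * Num.sqrt x.
Proof.
move=> x0; have s0 : 0 < Num.sqrt x by rewrite sqrtr_gt0.
rewrite -{1}(sqr_sqrtr (ltW x0)) lnXn// -[leLHS]mulr_natl ler_pM2l//.
exact/ltW/ln_sublinear.
Qed.

(** The difference is [ln p / (p * (p - 1))], where [ln p <= 2 * sqrt p] and [p - 1 >= p / 2]. The
    error is summable, by [sum_invsqrt3_le]. *)
Lemma ln_div_pred_le (R : realType) (p : nat) : (1 < p)%N ->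
  ln p%:R / p.-1%:R <= ln p%:R / p%:R + 4 * (Num.sqrt p%:R)^-1 ^+ 3 :> R.
Proof.
case: p => [|[|n]]// _; rewrite [n.+2.-1]/=; set p := n.+2%:R : R.
have p2 : 2 <= p by rewrite ler_nat.
have -> : n.+1%:R = p - 1 by rewrite /p -[n.+2%:R]natr1 addrK.
have /ln_le_2sqrt lnp : 0 < p by lra.
have s0 : 0 < Num.sqrt p by rewrite sqrtr_gt0; lra.
have E : ln p / (p - 1) - ln p / p = ln p / (p * (p - 1)).
  by field; apply/andP; split; lra.
rewrite -lerBlDl E exprVn.
have pp : 0 < p * (p - 1) by rewrite mulr_gt0; lra.
rewrite ler_pdivrMr// mulrAC ler_pdivlMr ?exprn_gt0//.
apply: le_trans (_ : 2 * Num.sqrt p * Num.sqrt p ^+ 3 <= _).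
  by rewrite ler_wpM2r// exprn_ge0// ltW.
rewrite -mulrA -exprS (_ : 4%N = (2 * 2)%N)// exprM sqr_sqrtr; nra.
Qed.

(** Both bounds come from estimating [ln N!] through its prime factorization and through Stirling's
    bounds. *)
Lemma mertens1 (R : realType) (N : nat) : (0 < N)%N ->
  `|\sum_(0 <= p < N.+1 | prime p) ln p%:R / p%:R - ln N%:R| <= 13 :> R.
Proof.
move=> N0; have n0 : 0 < N%:R :> R by rewrite ltr0n.
have L2 : ln 2 <= 1 :> R by apply: le_trans (ln_le_subr1 _) _; lra.
rewrite ler_norml; apply/andP; split; last first.
  (* Upper bound: [N / p] exceeds the exponent of [p] in [N!] by at most 1, and the resulting sum of
     [ln p] is at most [4 * N * ln 2]. *)
  rewrite -(ler_pM2l n0) mulrBr.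
  have : N%:R * (\sum_(0 <= p < N.+1 | prime p) ln p%:R / p%:R) <=
      ln (N`!)%:R + \sum_(0 <= p < N.+1 | prime p) ln p%:R :> R.
    rewrite ln_factE mulr_sumr -big_split/=; apply: ler_sum => p pr.
    have p0 : 0 < p%:R :> R by rewrite ltr0n prime_gt0.
    rewrite mulrCA -[X in _ + X]mul1r -mulrDl [leRHS]mulrC ler_wpM2l ?ln_natr_ge0//.
    rewrite ler_pdivrMr// natr1 -natrM ler_nat.
    apply: (@leq_trans ((N %/ p).+1 * p)); first by rewrite ltnW// ltn_ceil// prime_gt0.
    by rewrite leq_mul2r ltnS logn_fact_ge// orbT.
  have := theta_le R N; have := ln_fact_le R N.
  have : N%:R * ln 2 <= N%:R * 1 :> R by rewrite ler_pM2l.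
  lra.
(* Lower bound: the exponent of [p] is at most [N / (p - 1)]. The constant is [13 = 1 + 4 * 3], from
   Stirling and from replacing [p - 1] by [p]. *)
rewrite -(ler_pM2l n0) mulrBr.
have : ln (N`!)%:R <= N%:R * (\sum_(0 <= p < N.+1 | prime p) ln p%:R / p%:R) +
    N%:R * (4 * \sum_(0 <= p < N.+1) (Num.sqrt p%:R)^-1 ^+ 3) :> R.
  rewrite ln_factE -mulrDr.
  apply: le_trans (_ : N%:R * (\sum_(0 <= p < N.+1 | prime p)
    (ln p%:R / p%:R + 4 * (Num.sqrt p%:R)^-1 ^+ 3)) <= _).
    rewrite mulr_sumr; apply: ler_sum => p pr.
    have p0 : 0 < p.-1%:R :> R by rewrite ltr0n -ltnS prednK ?prime_gt1 ?prime_gt0.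
    apply: le_trans (ler_wpM2l (ltW n0) (ln_div_pred_le R (prime_gt1 pr))).
    rewrite mulrCA (mulrC _%:R) ler_wpM2l ?ln_natr_ge0//.
    by rewrite ler_pdivlMr// mulrC -natrM ler_nat logn_fact_le.
  rewrite ler_wpM2l ?(ltW n0)// big_split/= lerD2l mulr_sumr [leLHS]big_mkcond/=.
  by apply: ler_sum => p _; case: ifP.
have := ln_fact_ge R N.
have : N%:R * (4 * \sum_(0 <= p < N.+1) (Num.sqrt p%:R)^-1 ^+ 3) <= N%:R * (4 * 3) :> R.
  by rewrite !ler_pM2l// sum_invsqrt3_le.
lra.
Qed.

(* [ln p / p] on the primes and [ln n - ln (n - 1)] on all integers have partial
   sums at bounded distance; summation by parts against [1 / ln n] transfers
   this to [1 / p] and to an approximation of [ln (ln N)]. *)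
Lemma mertens2 (R : realType) : exists B : R, forall N, (1 < N)%N ->
  `|\sum_(0 <= p < N.+1 | prime p) (p%:R)^-1 - ln (ln N%:R)| <= B.
Proof.
have l2 : 0 < ln 2 :> R by rewrite ln_natr_gt0.
pose a n : R := (prime n)%:R * (ln n%:R / n%:R).
pose b n : R := ln n%:R - ln n.-1%:R.
pose f n : R := (ln n%:R)^-1.
pose V N := \sum_(2 <= n < N.+1) f n * b n.
have f_ge0 n : 0 <= f n by rewrite invr_ge0 ln_natr_ge0.
have f_le n : (1 < n)%N -> f n.+1 <= f n.
  by move=> n1; rewrite lef_pV2 ?posrE ?ln_natr_gt0 ?ler_ln_nat// ltnW.
(* Sums are restarted at 2, where [ln] is positive; at 1 the weight [f] takes the default value
   [0^-1 = 0] and is not monotone. *)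
have sumE n (F : nat -> R) : (0 < n)%N ->
    \sum_(0 <= p < n.+1 | prime p) F p = \sum_(2 <= p < n.+1) (prime p)%:R * F p.
  move=> n0; rewrite big_mkcond/= big_ltn// add0r; case: n n0 => // n _.
  rewrite big_ltn//= add0r; apply: eq_bigr => p _.
  by case: ifP; rewrite ?mul1r ?mul0r.
have AB n : (2 <= n)%N -> `|\sum_(2 <= i < n) (a i - b i)| <= 13.
  case: n => // n n1; rewrite big_split/= sumrN.
  rewrite (_ : \sum_(2 <= i < n.+1) b i = ln n%:R); last first.
    elim: n n1 => // -[|n] IHn _; first by rewrite big_geq// ln1.
    by rewrite big_nat_recr//= IHn// addrC subrK.
  by rewrite -sumE//; exact: mertens1.
have W N : (1 < N)%N -> `|\sum_(2 <= i < N) f i * (a i - b i)| <= 13 * f 2%N.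
  move=> N1; apply: le_trans (@summation_by_parts_le _ f _ 13 2 N N1 _) _.
    by move=> n /andP[n2 _]; exact: AB.
  rewrite ler_wpM2l// ger0_norm//.
  rewrite (@eq_big_nat _ _ _ _ _ _ (fun i => - (f i.+1 - f i))); last first.
    by move=> i /andP[i2 _]; rewrite ler0_norm// subr_le0 f_le.
  by rewrite sumrN telescope_sumr//; lra.
have b_ge0 n : 0 <= b n by rewrite subr_ge0 ler_ln_nat// leq_pred.
have bE n : (0 < n)%N -> b n.+1 = ln (n.+1%:R / n%:R).
  by move=> n0; rewrite ln_div ?posrE ?ltr0n.
have b_le1 n : (0 < n)%N -> b n.+1 <= 1.
  move=> n0; rewrite bE//; apply: le_trans (ln_le_subr1 _) _.
    by rewrite divr_gt0 ?ltr0n.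
  have n0' : 0 < n%:R :> R by rewrite ltr0n.
  have : 1 <= n%:R :> R by rewrite ler1n.
  by rewrite lerBlDr ler_pdivrMr// -natr1; lra.
(* The bounds [1 - 1/y <= ln y <= y - 1] at [y = ln (n + 1) / ln n] give [f (n + 1) * b (n + 1)] and
   [f n * b (n + 1)]; since [b <= 1], their gap is at most a telescoping difference of [f]. *)
have lnln n : (1 < n)%N -> f n.+1 * b n.+1 <= ln (ln n.+1%:R) - ln (ln n%:R)
    /\ ln (ln n.+1%:R) - ln (ln n%:R) <= f n.+1 * b n.+1 + (f n - f n.+1).
  move=> n1; have x0 : 0 < ln n%:R :> R by rewrite ln_natr_gt0.
  have y0 : 0 < ln n.+1%:R :> R by rewrite ln_natr_gt0// ltnW.
  rewrite -ln_div ?posrE//; split.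
    apply: le_trans (ln_ge_1subV _); last by rewrite divr_gt0.
    by rewrite invf_div /f /b /= mulrBr mulVf ?lt0r_neq0// mulrC.
  apply: le_trans (ln_le_subr1 _) _; first by rewrite divr_gt0.
  have -> : ln n.+1%:R / ln n%:R - 1 = f n * b n.+1.
    by rewrite /f /b/= mulrBr mulVf ?lt0r_neq0// mulrC.
  have : (f n - f n.+1) * b n.+1 <= (f n - f n.+1) * 1.
    by rewrite ler_wpM2l ?b_le1 ?(ltnW n1)// subr_ge0 f_le.
  lra.
have V_le N : (1 < N)%N ->
    V N <= ln (ln N%:R) - ln (ln 2) + 1 /\ ln (ln N%:R) <= V N + ln (ln 2) + f 2%N - f N.
  elim: N => // N IHN; rewrite ltnS leq_eqVlt => /predU1P[<-|N1].
    rewrite /V big_nat1 subrr add0r; split; last first.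
      by rewrite addrK; have := mulr_ge0 (f_ge0 2%N) (b_ge0 2%N); lra.
    by rewrite /b/= ln1 subr0 mulVf// lt0r_neq0.
  have VS : V N.+1 = V N + f N.+1 * b N.+1 
    by rewrite /V big_nat_recr//; exact: ltnW.
  have [? ?] := IHN N1; have [? ?] := lnln _ N1.
  by rewrite VS; split; lra.
exists (13 * f 2%N + 1 + `|ln (ln 2)| + f 2%N) => N N1.
rewrite sumE; last exact: ltnW.
have -> : \sum_(2 <= p < N.+1) (prime p)%:R * p%:R^-1 =
    \sum_(2 <= i < N.+1) f i * (a i - b i) + V N.
  rewrite -big_split; apply: eq_big_nat => i /andP[i1 _] /=.
  rewrite /a /f; have : ln i%:R != 0 :> R by rewrite lt0r_neq0// ln_natr_gt0.
  have : i%:R != 0 :> R by rewrite pnatr_eq0 -lt0n ltnW.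
  by move=> ? ?; field; apply/andP.
have /ler_normlP[? ?] := W N.+1 (ltnW N1); have [? ?] := V_le N N1.
have /ler_normlP[? ?] := lexx `|ln (ln 2) : R|.
have ? := f_ge0 N; have ? := f_ge0 2%N.
by apply/ler_normlP; split; lra.
Qed.

(** By [mertens1] the primes in [(N / M, N]] carry a sum of [ln p / p] at least 1, while each term
    is at most [ln N / (m + 1)] with [m = N %/ M]. Hence there are at least [(m + 1) / ln N] of
    them. *)
Lemma prime_count_ge (R : realType) : exists c : R, 0 < c /\
  \forall N \near \oo, c * N%:R / ln N%:R <= \sum_(0 <= p < N.+1 | prime p) 1.
Proof.
(* The threshold is [27 = 1 + 2 * 13]: the error of [mertens1] is paid at both ends of the
   interval. *)
have [M M_ge] : exists M : nat, 27 <= ln M%:R :> R.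
  exists (Num.truncn (expR 27 : R)).+1.
  rewrite -[leLHS]expRK ler_ln ?posrE ?expR_gt0 ?ltr0n//.
  exact/ltW/truncnS_gt.
have M0 : (0 < M)%N by case: M M_ge => //; rewrite ln0//; lra.
exists M%:R^-1; rewrite invr_gt0 ltr0n; split => //.
exists (maxn 2 M) => // N /=; rewrite geq_max => /andP[N2 MN].
pose m := (N %/ M)%N; have m0 : (0 < m)%N by rewrite divn_gt0.
have N0 : (0 < N)%N by exact: ltnW.
have mN : (m <= N)%N by exact: leq_div.
have lnN : 0 < ln N%:R :> R by rewrite ln_natr_gt0.
pose S := \sum_(m.+1 <= p < N.+1 | prime p) (ln p%:R / p%:R : R).
have S1 : 1 <= S.
  have /ler_normlP[_] := mertens1 R m0; have /ler_normlP[+ _] := mertens1 R N0.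
  rewrite (@big_cat_nat _ _ _ m.+1)//= -/S.
  have : ln m%:R + ln M%:R <= ln N%:R :> R.
    by rewrite -lnM ?posrE ?ltr0n// -natrM ler_ln_nat// leq_divM.
  lra.
rewrite ler_pdivrMr//; have m1 : 0 < m.+1%:R :> R by [].
apply: le_trans (_ : m.+1%:R <= _).
  rewrite mulrC ler_pdivrMr ?ltr0n// -natrM ler_nat ltnW// ltn_ceil//.
rewrite -[leLHS]mulr1; apply: le_trans (ler_wpM2l (ltW m1) S1) _.
rewrite [X in _ <= X * _](@big_cat_nat _ _ _ m.+1)//= mulrDl.
rewrite -[leLHS]add0r lerD ?mulr_ge0 ?sumr_ge0 ?(ltW lnN)//.
rewrite mulr_sumr mulr_suml big_seq_cond [leRHS]big_seq_cond; apply: ler_sum.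
move=> p; rewrite mem_index_iota => /andP[/andP[mp pN] pr].
rewrite mul1r mulrA ler_pdivrMr ?ltr0n ?prime_gt0// mulrC.
by apply: ler_pM; rewrite ?ln_natr_ge0 ?ler_ln_nat ?ler_nat.
Qed.

(** * Characters with values in {-1, 0, 1} *)

(** The form of [is_quadratic_residue] for any finite ring; at ['Z_q] the two are convertible. *)
Definition is_square_unit (T : finComUnitRingType) (b : T) : bool :=
  [exists u : T, (u \is a GRing.unit) && (b == u ^+ 2)].

(* A quadratic character is encoded by the set of units where it is 1. *)
Definition quad_chars (T : finComUnitRingType) : {set {set T}} :=
  [set H : {set T} | [&& H \subset [set x | x \is a GRing.unit]%SET, 1 \in H &
    [forall x, forall y, (x \is a GRing.unit) ==> (y \is a GRing.unit) ==>
      ((x * y \in H) == ((x \in H) == (y \in H)))]]]%SET.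

Definition quad_char (R : realType) (T : finComUnitRingType) (H : {set T})
    (x : T) : R :=
  if x \is a GRing.unit then (-1) ^+ (x \notin H) else 0.

Lemma quad_charsP (T : finComUnitRingType) (H : {set T}) :
  reflect [/\ {in H, forall x, x \is a GRing.unit}, 1 \in H &
    forall x y, x \is a GRing.unit -> y \is a GRing.unit ->
      (x * y \in H) = ((x \in H) == (y \in H))] (H \in quad_chars T).
Proof.
rewrite inE; apply: (iffP and3P) => -[HU H1 HM]; split => //.
- by move=> x xH; have := fintype.subsetP HU _ xH; rewrite inE.
- move=> x y xU yU; move/forallP: HM => /(_ x)/forallP/(_ y).
  by rewrite xU yU => /eqP.
- by apply/fintype.subsetP => x /HU; rewrite inE.
- apply/forallP => x; apply/forallP => y; apply/implyP => xU; apply/implyP => yU.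
  by rewrite HM.
Qed.

Lemma quad_charM (R : realType) (T : finComUnitRingType) (H : {set T}) (x y : T) :
  H \in quad_chars T -> quad_char R H (x * y) = quad_char R H x * quad_char R H y.
Proof.
move=> /quad_charsP[_ _ HM]; rewrite /quad_char unitrM.
have [xU|] := boolP (x \is a GRing.unit); last by rewrite mul0r.
have [yU|] := boolP (y \is a GRing.unit); last by rewrite mulr0.
rewrite /= HM//; case: (x \in H) (y \in H) => -[] /=;
  by rewrite ?expr0 ?expr1 ?mulr1 ?mul1r ?mulrNN ?mulr1.
Qed.

Lemma units_quad_chars (T : finComUnitRingType) :
  [set x : T | x \is a GRing.unit]%SET \in quad_chars T.
Proof.
apply/quad_charsP; split => [x|| x y xU yU]; rewrite !inE ?unitr1//.
by rewrite unitrM xU yU.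
Qed.

(* A set of units maximal among those that are closed under products, contain
   the squares and miss [a] has index 2 in the group of units. *)
Lemma exists_quad_char (T : finComUnitRingType) (a : T) :
  a \is a GRing.unit -> ~~ is_square_unit a ->
  exists2 H : {set T}, H \in quad_chars T & a \notin H.
Proof.
move=> aU aN.
pose P (H : {set T}) := [&& H \subset [set x | x \is a GRing.unit]%SET, a \notin H,
  [forall u, (u \is a GRing.unit) ==> (u ^+ 2 \in H)] &
  [forall x in H, forall y in H, x * y \in H]].
have P0 : P [set b | is_square_unit b]%SET.
  apply/and4P; split; first 1 last.
  - by rewrite inE.
  - apply/forallP => u; apply/implyP => uU; rewrite inE; apply/existsP; exists u.
    by rewrite uU eqxx.
  - apply/forall_inP => x; rewrite inE => /existsP[u /andP[uU /eqP ->]].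
    apply/forall_inP => y; rewrite inE => /existsP[v /andP[vU /eqP ->]].
    by rewrite inE; apply/existsP; exists (u * v); rewrite unitrM uU vU exprMn/=.
  - apply/fintype.subsetP => b; rewrite !inE => /existsP[u /andP[uU /eqP ->]].
    by rewrite unitrX.
have [H /maxsetP[PH Hmax] _] := maxset_exists P0.
have /and4P[/fintype.subsetP HU aH /forallP Hsq /forall_inP Hmul] := PH.
have {}HU x : x \in H -> x \is a GRing.unit by move=> /HU; rewrite inE.
have {}Hsq u : u \is a GRing.unit -> u ^+ 2 \in H by move=> uU; have := Hsq u; rewrite uU.
have {}Hmul x y : x \in H -> y \in H -> x * y \in H.
  by move=> xH yH; have /forall_inP := Hmul _ xH; apply.
(* Invariance under squares replaces closure under inverses, since [u^-1] and [u] differ by a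
   square. *)
have HsqK x u : u \is a GRing.unit -> (x * u ^+ 2 \in H) = (x \in H).
  move=> uU; apply/idP/idP => [xuH|xH]; last by rewrite Hmul// Hsq.
  rewrite -[x](mulrK (unitrX 2 uU)) -exprVn; apply: Hmul => //.
  by apply: Hsq; rewrite unitrV.
(* Adjoining to [H] the units [y] with [x * y \in H] keeps all the closure properties, so by
   maximality the enlarged set must contain [a]. *)
have coset x : x \is a GRing.unit -> x \notin H -> x * a \in H.
  move=> xU xH; pose K := H :|: [set y | (y \is a GRing.unit) && (x * y \in H)]%SET.
  have xK : x \in K by rewrite !inE xU -expr2 Hsq ?orbT.
  have [aK|aK] := boolP (a \in K).
    by move: aK; rewrite !inE (negbTE aH) aU.
  suff PK : P K.
    by move: xK; rewrite (Hmax _ PK) ?finset.subsetUl// (negbTE xH).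
  apply/and4P; split=> //.
  - by apply/fintype.subsetP => y; rewrite !inE => /orP[/HU|/andP[]].
  - by apply/forallP => u; apply/implyP => uU; rewrite inE Hsq.
  - apply/forall_inP => y yK; apply/forall_inP => z zK; move: yK zK; rewrite !inE.
    move=> /orP[yH|/andP[yU xyH]] /orP[zH|/andP[zU xzH]].
    + by rewrite Hmul.
    + by apply/orP; right; rewrite unitrM (HU _ yH) zU/= mulrCA Hmul.
    + by apply/orP; right; rewrite unitrM yU (HU _ zH)/= mulrA Hmul.
    + apply/orP; left; rewrite -(HsqK _ _ xU) expr2 mulrACA (mulrC y) (mulrC z).
      exact: Hmul.
exists H => //; apply/quad_charsP; split => //.
  by rewrite -(expr1n _ 2) Hsq// unitr1.
move=> x y xU yU.
have key u v : u \is a GRing.unit -> u \in H -> v * u \in H -> v \in H.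
  by move=> uU uH vuH; rewrite -(HsqK _ _ uU) expr2 mulrA Hmul.
have [xH|xH] := boolP (x \in H); have [yH|yH] := boolP (y \in H) => /=.
- exact: Hmul.
- by apply/negbTE; apply: contra yH; rewrite mulrC; exact: key.
- by apply/negbTE; apply: contra xH; exact: key.
- by rewrite -(HsqK _ _ aU) expr2 mulrACA; apply: Hmul; exact: coset.
Qed.

(** Otherwise squaring would be surjective, hence injective, on the finite set of units; but 1 and
    -1 have the same square. *)
Lemma exists_nonsquare_unit (T : finComUnitRingType) :
  (-1 : T) != 1 -> exists2 a : T, a \is a GRing.unit & ~~ is_square_unit a.
Proof.
move=> N1; pose U := [set x : T | x \is a GRing.unit]%SET.
apply: contrapT => noa.
have sqU : [set x ^+ 2 | x in U]%SET = U.
  apply/setP => a; rewrite inE; apply/imsetP/idP => [[u]|aU].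
    by rewrite inE => uU ->; rewrite unitrX.
  have [/existsP[u /andP[uU /eqP ->]]|aN] := boolP (is_square_unit a).
    by exists u; rewrite ?inE.
  by case: noa; exists a.
have /imset_injP inj : #|[set x ^+ 2 | x in U]%SET| == #|U| by rewrite sqU.
move/eqP: N1; apply; apply: inj; rewrite ?inE ?unitrN ?unitr1//.
by rewrite sqrrN.
Qed.

(** Orthogonality for the characters of order dividing 2: every term is 1 at a square unit and 0 at
    a nonunit, and the terms cancel at the other units. *)
Lemma sum_quad_char (R : realType) (T : finComUnitRingType) (a : T) :
  \sum_(H in quad_chars T) quad_char R H a =
    #|quad_chars T|%:R * (is_square_unit a)%:R.
Proof.
have [/existsP[u /andP[uU /eqP ->]]|aN] := boolP (is_square_unit a).
  rewrite mulr1 -sum1_card natr_sum; apply: eq_bigr => H.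
  by move=> /quad_charsP[_ _ HM]; rewrite /quad_char unitrX// expr2 HM// eqxx.
rewrite mulr0; have [aU|aU] := boolP (a \is a GRing.unit); last first.
  by rewrite big1// => H _; rewrite /quad_char (negbTE aU).
have [H0 /quad_charsP[H0U H01 H0M] aH0] := exists_quad_char aU aN.
(* Multiplication by a character that is -1 at [a] changes the sign of the sum. *)
pose tw (H : {set T}) := [set x | (x \is a GRing.unit) && ((x \in H) == (x \in H0))]%SET.
have twP H : H \in quad_chars T -> tw H \in quad_chars T.
  move=> /quad_charsP[HU H1 HM]; apply/quad_charsP; split.
  - by move=> x; rewrite inE => /andP[].
  - by rewrite inE unitr1 H1 H01.
  - move=> x y xU yU; rewrite !inE unitrM xU yU HM// H0M//=.
    by do 4 case: (_ \in _).
have twK H : H \in quad_chars T -> tw (tw H) = H.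
  move=> /quad_charsP[HU _ _]; apply/setP => x; rewrite !inE.
  have [xU|xU] := boolP (x \is a GRing.unit); last first.
    by apply/esym/negbTE; apply: contra xU; exact: HU.
  by do 2 case: (_ \in _).
suff E : \sum_(H in quad_chars T) quad_char R H a =
    - \sum_(H in quad_chars T) quad_char R H a by lra.
rewrite {1}(reindex_onto tw tw) => [|H HQ]; last exact: twK.
rewrite -sumrN; apply: eq_big => [H|H /andP[/twP HQ /eqP <-]].
  apply/andP/idP => [[/twP + /eqP <-]//|HQ].
  by rewrite twP// twK.
rewrite /quad_char aU !inE aU (negbTE aH0) /=.
by case: (a \in H); rewrite /= ?expr0 ?expr1 ?opprK.
Qed.

(** The principal character and one that is -1 at a nonsquare unit. This makes the constant of the
    bias positive. *)
Lemma card_quad_chars_gt1 (T : finComUnitRingType) :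
  (-1 : T) != 1 -> (1 < #|quad_chars T|)%N.
Proof.
move=> /exists_nonsquare_unit[a aU aN].
have [H HQ aH] := exists_quad_char aU aN.
apply/card_gt1P; exists [set x : T | x \is a GRing.unit]%SET, H.
split => //; first exact: units_quad_chars.
by apply: contraNneq aH => <-; rewrite inE.
Qed.

Lemma quad_char_units (R : realType) (T : finComUnitRingType) (a : T) :
  quad_char R [set x : T | x \is a GRing.unit]%SET a = (a \is a GRing.unit)%:R.
Proof. by rewrite /quad_char inE; case: (a \is a GRing.unit). Qed.

Lemma quad_char_nontrivial (R : realType) (q : nat) (H : {set 'Z_q}) :
  H \in quad_chars 'Z_q -> H != [set x | x \is a GRing.unit]%SET ->
  nontrivial_characters R q [ffun a => (quad_char R H a)%:C].
Proof.
move=> HQ HN; have /quad_charsP[HU H1 HM] := HQ; split.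
  split.
  - by rewrite ffunE /quad_char unitr1 H1 expr0.
  - by move=> a b; rewrite !ffunE quad_charM// rmorphM.
  - move=> a; rewrite ffunE /quad_char; case: ifP => aU; last by rewrite eqxx.
    by rewrite rmorphXn rmorphN1 signr_eq0.
move=> /ffunP E; move/eqP: HN; apply; apply/setP => a; rewrite inE.
apply/idP/idP => [/HU//|aU]; have := E a; rewrite !ffunE /quad_char aU.
case: (a \in H) => //= /eqP; rewrite expr1 rmorphN1 -subr_eq0 -opprD oppr_eq0.
by rewrite -(natrD _ 1 1) pnatr_eq0.
Qed.

(** * Limits and logarithms of Euler products *)

(** The form in which both limits of the bias statement are established: an explicit rate against a
    diverging quantity. *)
Lemma cvg_dist_le_div (R : realType) (T : Type) (F : set_system T)
    (FF : Filter F) (g h : T -> R) (l K : R) :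
  h x @[x --> F] --> +oo -> (\forall x \near F, `|g x - l| <= K / h x) ->
  g x @[x --> F] --> l.
Proof.
move=> /cvgryPge hy gl; apply/cvgrPdist_le => e e0.
near=> x; rewrite distrC; apply: le_trans (_ : K / h x <= _); first by near: x.
have h0 : 0 < h x by apply: lt_le_trans ltr01 _; near: x; exact: hy.
by rewrite ler_pdivrMr// mulrC -ler_pdivrMr//; near: x; exact: hy.
Unshelve. all: by end_near. Qed.

Lemma cvg_truncn_infty (R : realType) :
  (Num.truncn x) @[x --> (+oo : set_system R)] --> \oo.
Proof.
move=> A [N _ NA]; rewrite /nbhs/= /fmap/=; near=> x.
have Nx : N%:R <= x by near: x; apply: nbhs_pinfty_ge; rewrite num_real.
by apply: NA; rewrite /= truncn_ge_nat// (le_trans _ Nx).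
Unshelve. all: by end_near. Qed.

Lemma cvg_ln_infty (R : realType) :
  ln x @[x --> (+oo : set_system R)] --> (+oo : set_system R).
Proof.
apply/cvgryPge => A; near=> x.
have Ax : expR A <= x by near: x; apply: nbhs_pinfty_ge; rewrite num_real.
by rewrite -(expRK A) ler_ln ?posrE ?expR_gt0// (lt_le_trans (expR_gt0 _) Ax).
Unshelve. all: by end_near. Qed.

Lemma cvg_lnln_infty (R : realType) :
  ln (ln x) @[x --> (+oo : set_system R)] --> (+oo : set_system R).
Proof. exact: cvg_comp (@cvg_ln_infty R) (@cvg_ln_infty R). Qed.

Lemma bounded_of_near (R : realType) (u : nat -> R) (B : R) :
  (\forall N \near \oo, `|u N| <= B) -> exists B' : R, forall N, `|u N| <= B'.
Proof.
move=> [N0 _ uB]; exists (`|B| + \sum_(0 <= i < N0) `|u i|) => N.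
have [NN|NN] := leqP N0 N.
  apply: le_trans (uB N NN) _; apply: le_trans (ler_norm B) _.
  by rewrite lerDl sumr_ge0.
rewrite big_mkord (bigD1 (Ordinal NN))//= addrCA lerDl addr_ge0//.
exact: sumr_ge0.
Qed.

(** With a positive order, the local factorization evaluated at the point itself would give the
    value 0. If no order existed, the default would be 0 as well. *)
Lemma m_chi_eq0 (R : realType) (q : nat) (chi : {ffun 'Z_q -> Cplx R}) :
  dirichlet_L chi (2^-1 : R)%:C != 0 -> m_chi chi = 0%N.
Proof.
rewrite /m_chi /order_at => L0; case: xgetP => // -[//|m] _ [g [_ _]].
move=> /nbhs_singleton E; move: L0; rewrite E subrr exprS !mul0r eqxx.
by [].
Qed.

(** Mean value theorem for the remainder, whose derivative is [c ^ 2 / (1 + c)]; the factor 4 bounds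
    [1 / (1 + c)] for [c >= - 3/4]. The range covers [1 / sqrt p] for all primes. *)
Lemma ln1D_taylor2 (R : realType) (u : R) : `|u| <= 3 / 4 ->
  `|ln (1 + u) - (u - u ^+ 2 / 2)| <= 4 * `|u| ^+ 3.
Proof.
move=> u34; pose f (x : R) := ln (1 + x) - x + 2^-1 * x ^+ 2.
pose df (x : R) := (1 + x)^-1 - 1 + x.
have fD (x : R) : -1 < x -> is_derive x 1 f (df x).
  move=> x1; have x0 : 0 < 1 + x by lra.
  have dl : is_derive x 1 ((@ln R) \o (fun y => 1 + y)) (1 + x)^-1.
    rewrite -[X in is_derive _ _ _ X]mulr1.
    apply: is_derive1_comp; first exact: is_derive1_ln.
    by apply: is_derive_eq; rewrite add0r mulr1.
  rewrite /f /df; apply: is_derive_eq.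
  by rewrite scaler1 -mulr_natl mulr1 /GRing.scale/=; lra.
have fc (a b : R) : -1 < a -> {within `[a, b], continuous f}.
  move=> a1; apply: derivable_within_continuous => x; rewrite in_itv/= => /andP[ax _].
  by have [] := fD x (lt_le_trans a1 ax).
have dfE (c : R) : `|c| <= `|u| -> `|df c| <= 4 * `|u| ^+ 2.
  move=> cu; have /ler_normlP[c1 c2] := le_trans cu u34.
  have c0 : 0 < 1 + c by lra.
  have -> : df c = c ^+ 2 / (1 + c) by rewrite /df; field; lra.
  rewrite normrM normrX normfV (gtr0_norm c0) ler_pdivrMr// mulrAC.
  have : `|c| ^+ 2 <= `|u| ^+ 2 by rewrite ler_sqr ?nnegrE.
  have := sqr_ge0 `|u|; nra.
have f0 : f 0 = 0 by rewrite /f addr0 ln1 expr0n/=; lra.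
have -> : ln (1 + u) - (u - u ^+ 2 / 2) = f u by rewrite /f; lra.
suff [c cu fE] : exists2 c, `|c| <= `|u| & `|f u| = `|df c * u|.
  by rewrite fE normrM exprSr mulrA ler_wpM2r// dfE.
have [u1 u2] := ler_normlP _ _ u34.
have [u0|u0] := leP 0 u.
  have fD0 x : x \in `]0, u[%R -> is_derive x 1 f (df x).
    by rewrite in_itv/= => /andP[x0 _]; apply: fD; lra.
  have [|c] := MVT_segment u0 fD0; first by apply: fc; lra.
  rewrite in_itv/= f0 !subr0 => /andP[c0 cu] ->; exists c => //.
  by rewrite !ger0_norm.
have fD0 x : x \in `]u, 0[%R -> is_derive x 1 f (df x).
  by rewrite in_itv/= => /andP[x0 _]; apply: fD; lra.
have [|c] := MVT_segment (ltW u0) fD0; first by apply: fc; lra.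
rewrite in_itv/= f0 !sub0r => /andP[c0 cu] fE; exists c.
  by rewrite !ler0_norm ?(ltW u0)// lerN2.
by rewrite -normrN fE mulrN normrN.
Qed.

(** * From Euler products to character sums over primes *)

Lemma quad_char_norm_le1 (R : realType) (T : finComUnitRingType) (H : {set T})
  (x : T) : `|quad_char R H x| <= 1.
Proof.
by rewrite /quad_char; case: ifP => _; rewrite ?normr0// normrX normrN1 expr1n.
Qed.

Lemma invsqrt_prime_le (R : realType) (p : nat) : prime p ->
  (Num.sqrt p%:R)^-1 <= 3 / 4 :> R.
Proof.
move=> /prime_gt1 p1; have p0 : 0 < p%:R :> R by rewrite ltr0n ltnW.
have s0 : 0 < Num.sqrt p%:R :> R by rewrite sqrtr_gt0.
rewrite -[leLHS]mul1r ler_pdivrMr//.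
have : 2 <= Num.sqrt p%:R ^+ 2 :> R by rewrite sqr_sqrtr ?ler_nat// ltW.
nra.
Qed.

Lemma quad_char_invsqrt_le (R : realType) (T : finComUnitRingType)
    (H : {set T}) (x : T) (p : nat) : prime p ->
  `|quad_char R H x * (Num.sqrt p%:R)^-1| <= 3 / 4.
Proof.
move=> pr; have r0 : 0 <= (Num.sqrt p%:R)^-1 :> R by rewrite invr_ge0 sqrtr_ge0.
rewrite normrM (ger0_norm r0); apply: le_trans (invsqrt_prime_le R pr).
by rewrite -[leRHS]mul1r ler_wpM2r// quad_char_norm_le1.
Qed.

(** As [m_chi] is 0, the bare Euler product tends to a nonzero limit. Its factors are real and
    positive, so it is eventually pinched between positive reals and its logarithm is bounded. *)
Lemma DRH_A_ln_bounded (R : realType) (q : nat) (H : {set 'Z_q}) :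
  let chi := [ffun a => (quad_char R H a)%:C] : {ffun 'Z_q -> Cplx R} in
  m_chi chi = 0%N -> DRH_A chi ->
  exists B : R, forall N, `|\sum_(0 <= p < N.+1 | prime p)
    ln (1 - quad_char R H p%:R * (Num.sqrt p%:R)^-1)| <= B.
Proof.
move=> chi m0 [l l0]; rewrite m0 => Fl.
pose g N : R := \prod_(0 <= p < N.+1 | prime p)
  (1 - quad_char R H p%:R * (Num.sqrt p%:R)^-1)^-1.
have fac_gt0 p : prime p ->
    0 < 1 - quad_char R H (p%:R : 'Z_q) * (Num.sqrt p%:R)^-1.
  by move=> /(quad_char_invsqrt_le R H p%:R)/ler_normlP[_]; lra.
have g_gt0 N : 0 < g N by apply: prodr_gt0 => p pr; rewrite invr_gt0 fac_gt0.
pose l1 := Num.sqrt (complex.Re l ^+ 2 + complex.Im l ^+ 2).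
have lE : `|l : R[i]| = l1%:C by rewrite normc_def.
have l1_gt0 : 0 < l1 by rewrite -ltcR -lE normr_gt0.
have near_g : \forall N \near \oo, l1 / 2 <= g N <= 2 * l1.
  have e0 : (0 : R[i]) < (l1 / 2)%:C by rewrite ltcR divr_gt0.
  have /cvgrPdist_lt /(_ _ e0) [M [_ FM]] := Fl.
  near=> N.
  (* The limit over real [x] is used at [x = N], where truncation is the identity. *)
  have /FM /= : M < N%:R by near: N; exact: nbhs_infty_gtr.
  rewrite natrK expr0 mul1r (_ : \prod_(_ < _ | _) _ = (g N)%:C :> R[i]); last first.
    rewrite /g big_mkord rmorph_prod; apply: eq_bigr => p _.
    by rewrite ffunE [RHS]fmorphV rmorphB rmorph1 rmorphM.
  move=> lg; have gN : `|(g N)%:C : R[i]| = (g N)%:C.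
    by rewrite ger0_norm// lecR ltW.
  apply/andP; split; rewrite -lecR.
    have := ler_distD (g N)%:C (l : R[i]) 0; rewrite !subr0 lE gN => h.
    have : l1%:C <= (l1 / 2)%:C + (g N)%:C :> R[i].
      by apply: le_trans h _; rewrite lerD2r ltW.
    by rewrite -rmorphD !lecR; lra.
  have := ler_distD (l : R[i]) (g N)%:C 0; rewrite !subr0 lE gN => h.
  have : (g N)%:C <= (l1 / 2)%:C + l1%:C :> R[i].
    by apply: le_trans h _; rewrite lerD2r distrC ltW.
  by rewrite -rmorphD !lecR; lra.
apply: (@bounded_of_near _ _ (`|ln (l1 / 2)| + `|ln (2 * l1)|)).
near=> N.
have -> : \sum_(0 <= p < N.+1 | prime p)
    ln (1 - quad_char R H (p%:R : 'Z_q) * (Num.sqrt p%:R)^-1) = - ln (g N).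
  rewrite /g ln_prod => [|p pr]; last by rewrite invr_gt0 fac_gt0.
  by rewrite -sumrN; apply: eq_bigr => p pr; rewrite lnV ?opprK// posrE fac_gt0.
have /andP[g1 g2] : l1 / 2 <= g N <= 2 * l1 by near: N.
have h1 : ln (l1 / 2) <= ln (g N) by rewrite ler_ln ?posrE// divr_gt0.
have h2 : ln (g N) <= ln (2 * l1) by rewrite ler_ln ?posrE// mulr_gt0.
have /ler_normlP[? ?] := lexx `|ln (l1 / 2)|.
have /ler_normlP[? ?] := lexx `|ln (2 * l1)|.
by rewrite normrN; apply/ler_normlP; split; lra.
Unshelve. all: by end_near. Qed.

(** A prime that is not a unit modulo [q] divides [q], so it is at most [q] and the bound does not
    depend on [N]. *)
Lemma nonunit_prime_sum_le (R : realType) (q : nat) (w : nat -> R) (N : nat) :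
  (1 < q)%N -> (forall n, 0 <= w n) ->
  0 <= \sum_(0 <= p < N.+1 | prime p)
    ((p%:R : 'Z_q) \isn't a GRing.unit)%:R * w p <= \sum_(0 <= n < q.+1) w n.
Proof.
move=> q1 w0; rewrite sumr_ge0/= => [|p _]; last by rewrite mulr_ge0.
have term p : prime p -> ((p%:R : 'Z_q) \isn't a GRing.unit)%:R * w p <=
    (p <= q)%:R * w p.
  move=> pr; rewrite ler_wpM2r// ler_nat; case: (leqP p q) => pq; first exact: leq_b1.
  rewrite unitZpE// coprime_sym prime_coprime//; case: (boolP (p %| q)%N) => //.
  by move=> /dvdn_leq => /(_ (ltnW q1)); rewrite leqNgt pq.
apply: le_trans (ler_sum _ (fun p pr => term p pr)) _.
apply: le_trans (_ : \sum_(0 <= p < N.+1) (p <= q)%:R * w p <= _).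
  rewrite [leLHS]big_mkcond; apply: ler_sum => p _.
  by case: ifP => // _; rewrite mulr_ge0.
have -> : \sum_(0 <= p < N.+1) (p <= q)%:R * w p =
    \sum_(0 <= p < N.+1 | (p <= q)%N) w p.
  by rewrite [RHS]big_mkcond; apply: eq_bigr => p _; case: ifP; rewrite ?mul1r ?mul0r.
case: (leqP N q) => Nq.
  rewrite [leRHS](@big_cat_nat _ _ _ N.+1)//= [leLHS]big_mkcond/=.
  rewrite -[leLHS]addr0 lerD ?sumr_ge0//; apply: ler_sum => p _.
  by case: ifP.
rewrite (@big_cat_nat _ _ _ q.+1)//=; last exact: ltnW.
rewrite [X in _ + X]big1_seq ?addr0; last first.
  by move=> p /andP[pq]; rewrite mem_index_iota ltnNge pq.
by rewrite [leLHS]big_mkcond; apply: ler_sum => p _; case: ifP.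
Qed.

Lemma quad_char_sum_invsqrt (R : realType) (q : nat) (H : {set 'Z_q}) (B0 : R) :
  (1 < q)%N ->
  (forall N, `|\sum_(0 <= p < N.+1 | prime p)
    ln (1 - quad_char R H p%:R * (Num.sqrt p%:R)^-1)| <= B0) ->
  exists B : R, forall N, (1 < N)%N ->
    `|\sum_(0 <= p < N.+1 | prime p) quad_char R H p%:R * (Num.sqrt p%:R)^-1
      + 2^-1 * ln (ln N%:R)| <= B.
Proof.
move=> q1 bd; have [M HM] := mertens2 R.
exists (B0 + 12 + M + \sum_(0 <= n < q.+1) (n%:R^-1 : R)) => N N1.
pose u p : R := quad_char R H (p%:R : 'Z_q) * (Num.sqrt p%:R)^-1.
pose nu p : R := ((p%:R : 'Z_q) \isn't a GRing.unit)%:R.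
pose err p : R := ln (1 + - u p) - (- u p - (- u p) ^+ 2 / 2).
(* Second-order expansion of [ln (1 - u)] solved for [u]; [u ^ 2] is [1 / p] except where the
   character vanishes, which [nu] corrects. *)
have uE p : u p = - ln (1 - u p) - 2^-1 * p%:R^-1 + 2^-1 * (nu p * p%:R^-1)
    + err p.
  rewrite /err; suff : u p ^+ 2 = p%:R^-1 - nu p * p%:R^-1.
    by rewrite sqrrN => ->; lra.
  rewrite /u /nu exprMn exprVn sqr_sqrtr// /quad_char.
  case: ifP => _; last by rewrite expr0n/= mul1r mul0r subrr.
  by rewrite sqrr_sign mul0r subr0 mul1r.
(* Here [12 = 4 * 3]: the cubic Taylor remainder summed with [sum_invsqrt3_le]. *)
have err_le : `|\sum_(0 <= p < N.+1 | prime p) err p| <= 12.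
  apply: le_trans (ler_norm_sum _ _ _) _.
  apply: le_trans (_ : \sum_(0 <= p < N.+1) 4 * (Num.sqrt p%:R)^-1 ^+ 3 <= _).
    have r0 p : 0 <= (Num.sqrt p%:R)^-1 :> R by rewrite invr_ge0 sqrtr_ge0.
    rewrite big_mkcond/=; apply: ler_sum => p _; case: ifP => [pr|_]; last first.
      by rewrite mulr_ge0// exprn_ge0.
    have u34 : `|- u p| <= 3 / 4 by rewrite normrN quad_char_invsqrt_le.
    apply: le_trans (ln1D_taylor2 u34) _; rewrite ler_pM2l// lerXn2r ?nnegrE//.
    rewrite normrN /u normrM (ger0_norm (r0 p)) -[leRHS]mul1r ler_wpM2r//.
    exact: quad_char_norm_le1.
  by rewrite -mulr_sumr; have := sum_invsqrt3_le R N; lra.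
clearbody err.
rewrite (eq_bigr (fun p => (- ln (1 - u p) - 2^-1 * p%:R^-1) +
  2^-1 * (nu p * p%:R^-1) + err p)); last by move=> p _; exact: uE.
rewrite !big_split/= !sumrN -!mulr_sumr.
have /ler_normlP[] : `|\sum_(0 <= p < N.+1 | prime p) ln (1 - u p)| <= B0 := bd N.
have /ler_normlP[] := HM N N1; have /ler_normlP[] := err_le.
have inv_ge0 n : 0 <= n%:R^-1 :> R by rewrite invr_ge0.
have /andP[] := nonunit_prime_sum_le N q1 inv_ge0.
rewrite -[\sum_(_ <= _ < _ | _) _%:R * _]/(\sum_(0 <= p < N.+1 | prime p) nu p * p%:R^-1).
set s1 := \sum_(_ <= _ < _ | _) _; set s2 := \sum_(_ <= _ < _) _.
set s3 := \sum_(_ <= _ < _ | _) err _; set s4 := \sum_(_ <= _ < _ | _) _^-1.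
set s5 := \sum_(_ <= _ < _ | _) ln _.
by move=> *; apply/ler_normlP; split; lra.
Qed.

(** Summation by parts against [sqrt p] removes the weights. This function increases from 0, so its
    last value and its total variation agree, whence the factor 2. *)
Lemma quad_char_count_le (R : realType) (q : nat) (H : {set 'Z_q}) (B : R) :
  (forall N, (1 < N)%N ->
    `|\sum_(0 <= p < N.+1 | prime p) quad_char R H p%:R * (Num.sqrt p%:R)^-1
      + 2^-1 * ln (ln N%:R)| <= B) ->
  forall N, (1 < N)%N ->
    `|\sum_(0 <= p < N.+1 | prime p) quad_char R H p%:R| <=
      2 * (B + `|ln (ln 2)| + ln N%:R) * Num.sqrt N.+1%:R.
Proof.
move=> bd N N1; have B0 : 0 <= B := le_trans (normr_ge0 _) (bd N N1).
pose f n : R := Num.sqrt n%:R.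
pose a p : R := if prime p then quad_char R H (p%:R : 'Z_q) * (f p)^-1 else 0.
set K := B + `|ln (ln 2)| + ln N%:R.
have f_ge n : 0 <= f n.+1 - f n by rewrite subr_ge0 ler_wsqrtr// ler_nat.
(* Below 3 the sum contains no prime; beyond that, [ln (ln n)] is crudely bounded by [ln N]. *)
have a_le n : (0 <= n <= N.+1)%N -> `|\sum_(0 <= i < n) a i| <= K.
  have K0 : 0 <= K by rewrite !addr_ge0// ln_natr_ge0.
  case: n => [|[|[|n]]].
  - by rewrite big_geq// normr0.
  - by rewrite big_nat1 /a/= normr0.
  - by rewrite big_ltn// big_nat1 /a/= addr0 normr0.
  rewrite /= ltnS => nN; rewrite /a -big_mkcond.
  have /ler_normlP[? ?] := bd n.+2 isT.
  have l2 : 0 < ln 2 :> R by rewrite ln_natr_gt0.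
  have ln0 : 0 < ln n.+2%:R :> R by rewrite ln_natr_gt0.
  have : ln n.+2%:R <= ln N%:R :> R by rewrite ler_ln_nat.
  have : ln (ln 2) <= ln (ln n.+2%:R) :> R by rewrite ler_ln ?posrE// ler_ln_nat.
  have := ln_sublinear ln0.
  have /ler_normlP[? ?] := lexx `|ln (ln 2) : R|.
  have := @ln_natr_ge0 R N.
  by move=> ? ? ? ?; rewrite /K; apply/ler_normlP; split; lra.
have -> : \sum_(0 <= p < N.+1 | prime p) quad_char R H (p%:R : 'Z_q) =
    \sum_(0 <= p < N.+1) f p * a p.
  rewrite big_mkcond; apply: eq_bigr => p _; rewrite /a; case: ifP => [pr|_].
    by rewrite mulrCA divff ?mulr1// lt0r_neq0// sqrtr_gt0 ltr0n prime_gt0.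
  by rewrite mulr0.
apply: le_trans (summation_by_parts_le f (leq0n _) a_le) _.
rewrite (eq_bigr (fun i => f i.+1 - f i)) => [|i _]; last by rewrite ger0_norm.
have f0 : f 0%N = 0 by rewrite /f mulr0n sqrtr0.
by rewrite telescope_sumr// ger0_norm ?sqrtr_ge0// f0 subr0 /f; lra.
Qed.

(** * Chebyshev bias *)

Lemma cvg_sqrt_sqrt_nat (R : realType) :
  Num.sqrt (Num.sqrt (n%:R : R)) @[n --> \oo] --> (+oo : set_system R).
Proof.
apply/cvgryPge => A; near=> n.
have A2 : `|A| ^+ 2 ^+ 2 <= n%:R :> R by near: n; exact: nbhs_infty_ger.
apply: le_trans (ler_norm A) _.
have -> : `|A| = Num.sqrt (Num.sqrt (`|A| ^+ 2 ^+ 2)).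
  by rewrite sqrtr_sqr normrX normr_id sqrtr_sqr normr_id.
by rewrite !ler_wsqrtr.
Unshelve. all: by end_near. Qed.

(* All quantities are compared through [t = N^(1/4)]: [ln N <= 8 sqrt t] makes
   the defect [O(t^(5/2))] while [P1 + P2] is at least of order [t^(7/2)]. *)
Lemma cvg_ratio_of_small_defect (R : realType) (P1 P2 : nat -> R) (k K c : R) :
  0 < k -> 0 <= K -> 0 < c ->
  (forall N, (1 < N)%N -> `|P1 N - (k - 1) * P2 N| <=
    K * (1 + ln N%:R) * Num.sqrt N.+1%:R) ->
  (\forall N \near \oo, c * N%:R / ln N%:R <= P1 N + P2 N) ->
  P1 N / P2 N @[N --> \oo] --> k - 1.
Proof.
move=> k0 K0 c0 defect lower; pose K2 := 144 * K / c.
have K20 : 0 <= K2 by rewrite divr_ge0 ?(ltW c0)// mulr_ge0.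
apply: (@cvg_dist_le_div R _ _ _ _ _ _ (2 * k * K2) (@cvg_sqrt_sqrt_nat R)).
near=> N.
have tA : 2 * K2 + 1 <= Num.sqrt (Num.sqrt N%:R).
  by near: N; have /cvgryPge := @cvg_sqrt_sqrt_nat R; apply.
set t := Num.sqrt _ in tA *.
have t1 : 1 <= t by lra.
have t0 : 0 < t by lra.
have N1 : (1 < N)%N by near: N; exact: nbhs_infty_gt.
have NE : N%:R = t ^+ 4 :> R.
  by rewrite (_ : 4%N = (2 * 2)%N)// exprM !sqr_sqrtr ?sqrtr_ge0 ?ler0n.
pose s := Num.sqrt t; have s0 : 0 < s by rewrite sqrtr_gt0.
have sE : s ^+ 2 = t by rewrite sqr_sqrtr// ltW.
have s1 : 1 <= s by rewrite -[leLHS]sqrtr1 ler_wsqrtr.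
(* [ln N] is [4 * ln t], and [ln t <= 2 * sqrt t]. *)
have LN : ln N%:R <= 8 * s :> R.
  by rewrite NE lnXn// -mulr_natl; have := ln_le_2sqrt t0; rewrite -/s; lra.
have L0 : 0 < ln N%:R :> R by rewrite ln_natr_gt0.
have qN : Num.sqrt N.+1%:R <= 2 * t ^+ 2 :> R.
  have q0 : 0 <= 2 * t ^+ 2 by rewrite mulr_ge0// sqr_ge0.
  rewrite -(ger0_norm q0) -sqrtr_sqr ler_wsqrtr// exprMn -exprM -NE -natr1.
  by have : 1 <= N%:R :> R; [rewrite ler1n ltnW|lra].
have piN : c * N%:R / ln N%:R <= P1 N + P2 N by near: N.
set D := P1 N - (k - 1) * P2 N.
have DK : `|D| <= 18 * K * s * t ^+ 2.
  apply: le_trans (defect N N1) _.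
  apply: le_trans (_ : K * (9 * s) * (2 * t ^+ 2) <= _); last by lra.
  apply: ler_pM => //; first by rewrite mulr_ge0// addr_ge0// ltW.
  by rewrite ler_wpM2l//; lra.
have piE : P1 N + P2 N = k * P2 N + D by rewrite /D; ring.
set p := P1 N + P2 N in piN piE.
have pL : c * t ^+ 4 <= p * (8 * s).
  have := piN; rewrite ler_pdivrMr// {1}NE => /le_trans; apply.
  have p0 : 0 <= p.
    apply: le_trans piN; rewrite divr_ge0 ?mulr_ge0 ?(ltW c0) ?(ltW L0)//.
  by rewrite ler_wpM2l.
(* Combines [DK] with [pL]: a factor [s] is cancelled through [s ^ 2 = t], and [144 = 18 * 8]
   appears in [K2]. *)
have Dt : `|D| * t <= K2 * p.
  have h1 : `|D| * t * c <= 18 * K * s * t ^+ 3 * c.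
    by rewrite ler_wpM2r ?(ltW c0)// exprSr mulrA ler_wpM2r// ltW.
  have h2 : 18 * K * (c * t ^+ 4) <= 18 * K * (p * (8 * s)).
    by rewrite ler_wpM2l// mulr_ge0.
  have h3 : 18 * K * s * t ^+ 3 * c * s <= K2 * p * c * s.
    have -> : 18 * K * s * t ^+ 3 * c * s = 18 * K * (c * t ^+ 4).
      by rewrite [t ^+ 4]exprS -{2}sE; ring.
    have -> : K2 * p * c * s = 18 * K * (p * (8 * s)).
      by rewrite /K2; field; rewrite lt0r_neq0.
    exact: h2.
  rewrite -(ler_pM2r c0); apply: le_trans h1 _.
  by rewrite -(ler_pM2r s0).
have D0 : 0 <= `|D| by [].
have p0 : 0 < p.
  by apply: lt_le_trans piN; rewrite divr_gt0// mulr_gt0// ltr0n ltnW.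
(* Once [t] exceeds [2 * K2], the defect is at most half of the total, which bounds [P2] below by
   [p / (2 * k)]. *)
have Dp : 2 * `|D| <= p.
  have : (2 * K2 + 1) * `|D| <= t * `|D| by rewrite ler_wpM2r.
  rewrite -(ler_pM2r t0); nra.
have P20 : p <= 2 * (k * P2 N).
  by have /ler_normlP[? ?] := lexx `|D|; lra.
have P2gt0 : 0 < P2 N by rewrite -(pmulr_rgt0 _ k0); lra.
have -> : P1 N / P2 N - (k - 1) = D / P2 N.
  by rewrite /D; field; rewrite lt0r_neq0.
rewrite normrM normfV (gtr0_norm P2gt0) ler_pdivrMr// mulrAC ler_pdivlMr//.
apply: le_trans Dt _; rewrite (_ : 2 * k * K2 * P2 N = K2 * (2 * (k * P2 N))).
  by rewrite ler_wpM2l.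
by ring.
Unshelve. all: by end_near. Qed.

Lemma Zp_N1_neq1 (q : nat) : (3 <= q)%N -> (-1 : 'Z_q) != 1.
Proof.
move=> q3; have q1 : (1 < q)%N by exact: ltnW.
apply/eqP => E; have E2 : (2%:R : 'Z_q) = 0 by rewrite mulr2n -{1}E addNr.
by have := val_Zp_nat q1 2; rewrite E2 modn_small.
Qed.

(** At each prime, orthogonality without the principal character gives [k] times the indicator of
    squares minus that of units, with [k] the number of quadratic characters. Primes dividing [q]
    count as nonresidues and form the first sum. The weight is arbitrary, to cover both 1 and
    [1 / sqrt p]. *)
Lemma residue_sum_defect (R : realType) (q : nat) (w : nat -> R) (N : nat) :
  let U : {set 'Z_q} := [set x | x \is a GRing.unit]%SET in
  \sum_(0 <= p < N.+1 | nonresidue_primes q p) w p -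
    (#|quad_chars 'Z_q|%:R - 1) * \sum_(0 <= p < N.+1 | residue_primes q p) w p
  = \sum_(0 <= p < N.+1 | prime p) ((p%:R : 'Z_q) \isn't a GRing.unit)%:R * w p
    - \sum_(H in quad_chars 'Z_q :\ U)
        \sum_(0 <= p < N.+1 | prime p) quad_char R H (p%:R : 'Z_q) * w p.
Proof.
move=> U; rewrite exchange_big/= -sumrB.
rewrite mulr_sumr big_mkcond [X in _ - X]big_mkcond [RHS]big_mkcond -sumrB/=.
apply: eq_bigr => p _; rewrite /nonresidue_primes /residue_primes.
case: (prime p) => /=; last by rewrite subr0.
have := sum_quad_char R (p%:R : 'Z_q).
rewrite (big_setD1 U) ?units_quad_chars//= quad_char_units => E.
move/(canRL (addKr _)): E => E; rewrite -mulr_suml E addrC.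
rewrite -[is_square_unit _]/(is_quadratic_residue (p%:R : 'Z_q)).
by case: is_quadratic_residue; case: (p%:R \is a GRing.unit) => /=; ring.
Qed.

Theorem corollary3p2 (R : realType) (q : nat) (hq : (3 <= q)%N)
    (hDRH : forall chi : {ffun 'Z_q -> Cplx R},
      nontrivial_characters R q chi -> DRH_A chi)
    (hL : forall chi : {ffun 'Z_q -> Cplx R},
      nontrivial_characters R q chi -> dirichlet_L chi (2^-1 : R)%:C != 0)
    (hm : forall a : 'Z_q, a \is a GRing.unit -> m_sigma R a = 0) :
  chebyshev_bias R (nonresidue_primes q) (residue_primes q).
Proof.
have q1 : (1 < q)%N by exact: ltnW.
pose U : {set 'Z_q} := [set x | x \is a GRing.unit]%SET.
pose Q := quad_chars 'Z_q :\ U; pose k : R := #|quad_chars 'Z_q|%:R.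
have k1 : 1 < k by rewrite ltr1n card_quad_chars_gt1// Zp_N1_neq1.
have QE : #|Q|%:R = k - 1.
  by rewrite /k [in RHS](cardsD1 U) units_quad_chars natrD/= addrC addKr.
(* Membership in [Q] sits under the existential so that [choice] yields a bound defined for every
   [H]; outside [Q] the value 0 is a dummy. *)
have Sbd (H : {set 'Z_q}) : exists B : R, H \in Q -> forall N, (1 < N)%N ->
    `|\sum_(0 <= p < N.+1 | prime p) quad_char R H p%:R * (Num.sqrt p%:R)^-1
      + 2^-1 * ln (ln N%:R)| <= B.
  have [|] := boolP (H \in Q); last by exists 0.
  rewrite /Q in_setD1 => /andP[HU HQ].
  have nt := quad_char_nontrivial R HQ HU.
  have [B0 /(quad_char_sum_invsqrt q1)[B HB]] :=
    DRH_A_ln_bounded (m_chi_eq0 (hL _ nt)) (hDRH _ nt).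
  by exists B.
have {Sbd}[B BP] := choice Sbd.
pose r n : R := (Num.sqrt n%:R)^-1.
have r0 n : 0 <= r n by rewrite invr_ge0 sqrtr_ge0.
split.
- move=> p; rewrite /nonresidue_primes /residue_primes.
  by case: (prime p) => //=; rewrite orNb.
- move=> p; rewrite /nonresidue_primes /residue_primes.
  by case: (prime p) => //=; rewrite andNb.
exists (k - 1).
  have [c [c0 piN]] := prime_count_ge R.
  pose P1 N : R := \sum_(0 <= p < N.+1 | nonresidue_primes q p) 1.
  pose P2 N : R := \sum_(0 <= p < N.+1 | residue_primes q p) 1.
  have -> : (fun x : R => count_upto (nonresidue_primes q) x /
      count_upto (residue_primes q) x) =
      (fun N => P1 N / P2 N) \o (fun x => Num.truncn x).
    apply/funext => x; rewrite /count_upto /P1 /P2/= !big_mkord.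
    by rewrite -!sum1_card !natr_sum.
  apply: (cvg_comp _ _ (@cvg_truncn_infty R)).
  (* The first term counts the primes dividing [q]; each summand bounds one nonprincipal character
     after [1 + ln N] is factored out. *)
  pose K := q.+1%:R + \sum_(H in Q) 2 * (B H + `|ln (ln 2)| + 1).
  have BH0 (H : {set 'Z_q}) : H \in Q -> 0 <= B H.
    by move=> HQ; exact: le_trans (normr_ge0 _) (BP H HQ 2%N isT).
  have K0 : 0 <= K.
    by rewrite addr_ge0// sumr_ge0// => H HQ; rewrite mulr_ge0// !addr_ge0// BH0.
  apply: (@cvg_ratio_of_small_defect R P1 P2 k K c) => //; first by lra.
    move=> N N1; rewrite /P1 /P2 (@residue_sum_defect R q (fun=> 1)).
    have lN := @ln_natr_ge0 R N.
    have sN : 1 <= Num.sqrt N.+1%:R :> R.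
      by rewrite -[leLHS]sqrtr1 ler_wsqrtr// ler1n.
    apply: le_trans (ler_normB _ _) _; rewrite /K !mulrDl; apply: lerD.
      have /andP[h1 h2] := nonunit_prime_sum_le N q1 (fun=> ler01 : 0 <= 1 :> R).
      rewrite ger0_norm//; apply: le_trans h2 _.
      rewrite big_mkord sumr_const card_ord -mulrA -[leLHS]mulr1 ler_wpM2l//.
      by nra.
    apply: le_trans (ler_norm_sum _ _ _) _; rewrite !mulr_suml.
    apply: ler_sum => H HQ; under eq_bigr do rewrite mulr1.
    apply: le_trans (quad_char_count_le (BP H HQ) N1) _.
    rewrite ler_wpM2r ?sqrtr_ge0// -[leRHS]mulrA ler_wpM2l//.
    have : 0 <= B H + `|ln (ln 2)| by rewrite addr_ge0// BH0.
    by nra.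
  near=> N; have -> : P1 N + P2 N = \sum_(0 <= p < N.+1 | prime p) 1.
    rewrite /P1 /P2 [X in X + _]big_mkcond [X in _ + X]big_mkcond [RHS]big_mkcond.
    rewrite -big_split; apply: eq_bigr => p _.
    rewrite /nonresidue_primes /residue_primes; case: (prime p) => /=; last by rewrite addr0.
    by case: (is_quadratic_residue _); rewrite /= ?addr0 ?add0r.
  by near: N.
(* Each of the [k - 1] nonprincipal quadratic characters contributes one half. *)
exists ((k - 1) / 2); first by rewrite divr_gt0// subr_gt0.
pose D N : R := \sum_(0 <= p < N.+1 | nonresidue_primes q p) r p -
  (k - 1) * \sum_(0 <= p < N.+1 | residue_primes q p) r p.
pose M := \sum_(0 <= n < q.+1) r n + \sum_(H in Q) B H.
have DM N : (1 < N)%N -> `|D N - (k - 1) / 2 * ln (ln N%:R)| <= M.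
  move=> N1; rewrite /D residue_sum_defect.
  have -> : (k - 1) / 2 * ln (ln N%:R) = \sum_(H in Q) (2^-1 * ln (ln N%:R) : R).
    by rewrite sumr_const -[RHS]mulr_natl QE mulrA.
  rewrite -addrA -opprD -big_split/=.
  apply: le_trans (ler_normB _ _) (lerD _ _).
    by have /andP[h1 h2] := nonunit_prime_sum_le N q1 r0; rewrite ger0_norm.
  apply: le_trans (ler_norm_sum _ _ _) _; apply: ler_sum => H HQ.
  exact: BP.
pose C := (k - 1) / 2; have C0 : 0 < C by rewrite divr_gt0// subr_gt0.
(* [M] is the error at integers, and [C * ln 2] pays for replacing [ln (ln N)] by [ln (ln x)]. *)
apply: (@cvg_dist_le_div R _ _ _ _ _ _ ((M + C * ln 2) / C) (@cvg_lnln_infty R)).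
near=> x; have x2 : 2 <= x by near: x; apply: nbhs_pinfty_ge; rewrite num_real.
have xe : expR (expR 1) <= x by near: x; apply: nbhs_pinfty_ge; rewrite num_real.
set N := Num.truncn x.
have N1 : (1 < N)%N by rewrite truncn_ge_nat// ltW// (lt_le_trans _ x2).
have /andP[Nx xN] : N%:R <= x < N.+1%:R by apply: truncn_itv; lra.
have x0 : 0 < x by lra.
have LN0 : 0 < ln N%:R :> R by rewrite ln_natr_gt0.
have LNx : ln N%:R <= ln x by rewrite ler_ln ?posrE// ltr0n ltnW.
(* For [N >= 2], [x < N + 1 <= N ^ 2]. *)
have Lx : ln x <= 2 * ln N%:R.
  rewrite mulr_natl -lnXn ?ltr0n ?(ltnW N1)// ler_ln ?posrE ?exprn_gt0 ?ltr0n ?(ltnW N1)//.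
  apply: le_trans (ltW xN) _; rewrite -natrX ler_nat; move: N1; clear; nia.
have LLx : 1 <= ln (ln x).
  rewrite -[leLHS]expRK ler_ln ?posrE ?expR_gt0//; last by lra.
  by rewrite -[leLHS]expRK ler_ln ?posrE ?expR_gt0.
have h1 : ln (ln N%:R) <= ln (ln x) :> R by rewrite ler_ln ?posrE//; lra.
have h2 : ln (ln x) <= ln 2 + ln (ln N%:R) :> R.
  by rewrite -lnM ?posrE// ler_ln ?posrE//; lra.
have -> : sum_inv_sqrt (nonresidue_primes q) x -
    (k - 1) * sum_inv_sqrt (residue_primes q) x = D N.
  by rewrite /D /sum_inv_sqrt !big_mkord.
have -> : D N / (C * ln (ln x)) - 1 = (D N - C * ln (ln x)) / (C * ln (ln x)).
  by field; apply/andP; split; lra.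
rewrite normrM normfV [X in _ / X]ger0_norm ?mulr_ge0//; [|lra..].
rewrite invfM mulrA ler_wpM2r ?invr_ge0//; first by lra.
rewrite ler_wpM2r ?invr_ge0//; first by lra.
have /ler_normlP[] := DM N N1; rewrite -/C => h3 h4.
have h5 : C * ln (ln N%:R) <= C * ln (ln x) by rewrite ler_wpM2l// ltW.
have h6 : C * ln (ln x) <= C * (ln 2 + ln (ln N%:R)) by rewrite ler_wpM2l// ltW.
have h7 : 0 <= C * ln 2 by rewrite mulr_ge0 ?ln_natr_ge0// ltW.
by apply/ler_normlP; split; lra.
Unshelve. all: by end_near. Qed.
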